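(* Let a system of $n$ agents (nodes) satisfy: partial synchrony (a Global Stabilization Time GST exists), at most $f<n/2$ crash failures, and the communication graph remains connected among nonfaulty nodes (assume that the underlying network delivers messages between any nonfaulty pair after GST). Then $\mu$ACP can implement standard consensus protocols (e.g., Paxos-style) using its primitives (PING, ASK, TELL, OBSERVE, together with TLV options). Consequently, any coordination task reducible to consensus (uniform agreement on a value) is achievable: safety holds always, and liveness holds after GST under the stated failure bound.
   Context: **$\mu$ACP messages.** $\mu$ACP is an agent communication protocol whose messages are tuples $\langle hdr,v,O,p\rangle$ sent from one agent to another, where $v\in\{\mathrm{PING},\mathrm{TELL},\mathrm{ASK},\mathrm{OBSERVE}\}$ is the verb, $O$ is a finite sequence of TLV (type–length–value) options from a bounded set, $p$ is the payload, and the header $hdr$ encodes sequence and correlation identifiers and quality-of-service flags. To implement a protocol with the primitives of $\mu$ACP means to carry its messages as $\mu$ACP messages. **Partial synchrony.** There exists an unknown time GST after which every message on a stable channel is delivered within a bound $\Delta$; before GST delays may be unbounded. **Channels.** (i) Fair loss: infinitely many sends imply infinitely many deliveries; (ii) messages may be arbitrarily duplicated; (iii) there is no spurious creation of messages; (iv) channels are eventually timely after GST. **Failures.** Byzantine faults are excluded. **Safety and liveness.** Consensus means uniform agreement on a value. Safety means that bad states are avoided (for consensus: no two different values are chosen); liveness means eventual progress. *)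

(* Defs.v *)
From HB Require Import structures.
From mathcomp Require Import all_boot.

Set Implicit Arguments.
Unset Strict Implicit.
Unset Printing Implicit Defensive.

Definition byte := 'I_256.

Record tlv := Tlv {
  tlv_type : byte;
  tlv_length : nat;
  tlv_value : seq byte;
  _ : tlv_length == size tlv_value }.

Definition tlv_fields (o : tlv) : byte * nat * seq byte :=
  (tlv_type o, tlv_length o, tlv_value o).

Definition fields_tlv (x : byte * nat * seq byte) : option tlv :=
  if @idP (x.1.2 == size x.2) is ReflectT h then Some (@Tlv x.1.1 x.1.2 x.2 h)
  else None.

Lemma tlv_fieldsK : pcancel tlv_fields fields_tlv.
Proof.
case=> ty l v h; rewrite /fields_tlv /=.
by case: {-}_ / idP => // h'; rewrite (bool_irrelevance h' h).
Qed.

HB.instance Definition _ := Countable.copy tlv (pcan_type tlv_fieldsK).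

Inductive verb := PING | TELL | ASK | OBSERVE.

Definition verb_code (v : verb) : nat :=
  match v with PING => 0 | TELL => 1 | ASK => 2 | OBSERVE => 3 end.

Definition code_verb (k : nat) : verb :=
  match k with 0 => PING | 1 => TELL | 2 => ASK | _ => OBSERVE end.

Lemma verb_codeK : cancel verb_code code_verb. Proof. by case. Qed.

HB.instance Definition _ := Countable.copy verb (can_type verb_codeK).

Record header := Header { seq_id : nat; corr_id : nat; qos_flags : bitseq }.

Definition header_fields (h : header) := (seq_id h, corr_id h, qos_flags h).
Definition fields_header (x : nat * nat * bitseq) := Header x.1.1 x.1.2 x.2.

Lemma header_fieldsK : cancel header_fields fields_header. Proof. by case. Qed.

HB.instance Definition _ := Countable.copy header (can_type header_fieldsK).

(* The bounded set of admissible options is the list [B]; [seq_sub B] is the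
   finite type of its members.  Sender and receiver are not part of the tuple:
   they are attached to it by the channel (see [env] and [protocol]). *)
Record uacp_msg (B : seq tlv) := UacpMsg {
  msg_hdr : header;
  msg_verb : verb;
  msg_opts : seq (seq_sub B);
  msg_payload : seq byte }.

Definition msg_fields B (m : uacp_msg B) :=
  (msg_hdr m, msg_verb m, msg_opts m, msg_payload m).
Definition fields_msg B (x : header * verb * seq (seq_sub B) * seq byte) :=
  UacpMsg x.1.1.1 x.1.1.2 x.1.2 x.2.

Lemma msg_fieldsK B : cancel (@msg_fields B) (@fields_msg B).
Proof. by case. Qed.

HB.instance Definition _ B :=
  Countable.copy (uacp_msg B) (can_type (@msg_fieldsK B)).

(* Everything the agents do not control, over discrete global time:
   - [crash E p = Some c] if [p] crashes at time [c], [None] if [p] never does;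
   - [comm E] is the communication graph;
   - [sched E p t = Some ms] if [p] takes a step at time [t] and [ms] is the list
     of pairs (sender, message) delivered to it in that step, and [None] if [p]
     takes no step at time [t]. *)
Record env (n : nat) (M : eqType) := Env {
  crash : 'I_n -> option nat;
  comm : rel 'I_n;
  sched : 'I_n -> nat -> option (seq ('I_n * M)) }.

Section System.
Variables (n : nat) (M : eqType) (E : env n M).

(* [sends p t] lists the pairs (recipient, message) sent by [p] at time [t]. *)
Variable sends : 'I_n -> nat -> seq ('I_n * M).

Definition nonfaulty (p : 'I_n) : bool := ~~ isSome (crash E p).

Definition sent (p q : 'I_n) (m : M) (t : nat) : bool := (q, m) \in sends p t.

Definition delivered (p q : 'I_n) (m : M) (t : nat) : bool :=
  (p, m) \in odflt [::] (sched E q t).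

Definition linked : rel 'I_n :=
  connect [rel p q | [&& nonfaulty p, nonfaulty q & comm E p q]].

Definition stable_channel (p q : 'I_n) : bool :=
  [&& nonfaulty p, nonfaulty q & linked p q].

(* Steps read and write whole lists of messages, so a message may be delivered
   any number of times, even within one step: duplication is unrestricted.
   A message lost on the way from a faulty sender also accounts for a crash in
   the middle of a step. *)
Record system (f : nat) : Prop := {
  crash_stop : forall p c t, crash E p = Some c -> c <= t -> sched E p t = None;
  keeps_running : forall p t, nonfaulty p ->
    exists2 s, t <= s & isSome (sched E p s);
  crash_bound : #|[set p | ~~ nonfaulty p]| <= f;
  comm_sym : symmetric (comm E);
  comm_connected : forall p q, nonfaulty p -> nonfaulty q -> linked p q;
  no_creation : forall p q m t, delivered p q m t ->
    exists2 s, s < t & sent p q m s;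
  fair_loss : forall p q m, nonfaulty q ->
    (forall t, exists2 s, t <= s & sent p q m s) ->
    (forall t, exists2 s, t <= s & delivered p q m s) }.

(* Messages sent before [GST] may be lost or delayed without bound. *)
Definition partially_synchronous : Prop :=
  exists GST Delta : nat, forall p q m s,
    GST <= s -> stable_channel p q -> sent p q m s ->
    exists2 t, s < t <= s + Delta & delivered p q m t.

End System.

(* An agent knows its identity and its input; in each step it consumes the
   delivered messages and produces messages to send.  It has no access to the
   global time, hence none to [GST] and [Delta]. *)
Record protocol (n : nat) (M : eqType) (In Out : Type) := Protocol {
  pstate : Type;
  pinit : 'I_n -> In -> pstate;
  pstep : 'I_n -> pstate -> seq ('I_n * M) -> pstate * seq ('I_n * M);
  pout : pstate -> option Out }.

Section Run.
Variables (n : nat) (M : eqType) (In Out : Type) (P : protocol n M In Out).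
Variables (x : 'I_n -> In) (E : env n M).

(* State of [p] just before time [t]. *)
Fixpoint state (p : 'I_n) (t : nat) : pstate P :=
  if t is t'.+1 then
    if sched E p t' is Some ms then (pstep p (state p t') ms).1
    else state p t'
  else pinit P p (x p).

Definition psends (p : 'I_n) (t : nat) : seq ('I_n * M) :=
  if sched E p t is Some ms then (pstep p (state p t) ms).2 else [::].

Definition poutput (t : nat) (p : 'I_n) : option Out := pout (state p t).

End Run.

(* [T x y] holds if the partial output vector [y] (undefined for the agents that
   have produced no output) is acceptable for the input vector [x]. *)
Definition task (n : nat) (In Out : Type) : Type :=
  ('I_n -> In) -> ('I_n -> option Out) -> Prop.

(* Outputs of agents that crash later on are constrained as well. *)
Definition consensus (n : nat) (V : Type) : task n V V := fun x y =>
  (forall p q v w, y p = Some v -> y q = Some w -> v = w) /\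
  (forall p v, y p = Some v -> exists q, x q = v).

Definition safe (n : nat) (In Out : Type) (T : task n In Out)
    (x : 'I_n -> In) (out : nat -> 'I_n -> option Out) : Prop :=
  (forall t, T x (out t)) /\
  (forall s t p o, s <= t -> out s p = Some o -> out t p = Some o).

Definition live (n : nat) (M : eqType) (Out : Type) (E : env n M)
    (out : nat -> 'I_n -> option Out) : Prop :=
  forall p, nonfaulty E p -> exists t, isSome (out t p).

(* Safety does not depend on the existence of a stabilization time. *)
Definition solves (n f : nat) (M : eqType) (In Out : Type)
    (P : protocol n M In Out) (T : task n In Out) : Prop :=
  forall (x : 'I_n -> In) (E : env n M), system E (psends P x E) f ->
    safe T x (poutput P x E) /\
    (partially_synchronous E (psends P x E) -> live E (poutput P x E)).

Section Carry.
Variables (n : nat) (M M' : eqType) (In Out : Type).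
Variables (enc : M -> M') (dec : M' -> option M).

Definition decode_all (ms : seq ('I_n * M')) : seq ('I_n * M) :=
  pmap (fun d => omap (pair d.1) (dec d.2)) ms.

Definition carry (P : protocol n M In Out) : protocol n M' In Out :=
  @Protocol n M' In Out (pstate P) (@pinit _ _ _ _ P)
    (fun p s ms => let r := pstep p s (decode_all ms) in
       (r.1, [seq (d.1, enc d.2) | d <- r.2]))
    (@pout _ _ _ _ P).

End Carry.

(* [Q] is [P] with its messages carried as muACP messages. *)
Definition implements (n : nat) (M : eqType) (In Out : Type) (B : seq tlv)
    (Q : protocol n (uacp_msg B) In Out) (P : protocol n M In Out) : Prop :=
  exists (enc : M -> uacp_msg B) (dec : uacp_msg B -> option M),
    pcancel enc dec /\ Q = carry enc dec P.

(* A protocol with access to consensus objects indexed by [nat]: a step also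
   consumes responses (instance, decided value), and produces proposals
   (instance, proposed value). *)
Record cprotocol (n : nat) (M : eqType) (V In Out : Type) := CProtocol {
  cstate : Type;
  cinit : 'I_n -> In -> cstate;
  cstep : 'I_n -> cstate -> seq ('I_n * M) -> seq (nat * V) ->
    cstate * seq ('I_n * M) * seq (nat * V);
  cout : cstate -> option Out }.

Section CRun.
Variables (n : nat) (M V : eqType) (In Out : Type).
Variables (R : cprotocol n M V In Out) (x : 'I_n -> In) (E : env n M).

(* [resp p t] lists the responses handed to [p] at time [t]; it is read only if
   [p] takes a step at that time. *)
Variable resp : 'I_n -> nat -> seq (nat * V).

Fixpoint crun_state (p : 'I_n) (t : nat) : cstate R :=
  if t is t'.+1 then
    if sched E p t' is Some ms then
      (cstep p (crun_state p t') ms (resp p t')).1.1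
    else crun_state p t'
  else cinit R p (x p).

Definition csends (p : 'I_n) (t : nat) : seq ('I_n * M) :=
  if sched E p t is Some ms then
    (cstep p (crun_state p t) ms (resp p t)).1.2 else [::].

Definition proposed (p : 'I_n) (k : nat) (v : V) (t : nat) : bool :=
  if sched E p t is Some ms then
    (k, v) \in (cstep p (crun_state p t) ms (resp p t)).2 else false.

Definition responded (p : 'I_n) (k : nat) (v : V) (t : nat) : bool :=
  isSome (sched E p t) && ((k, v) \in resp p t).

Definition coutput (t : nat) (p : 'I_n) : option Out := cout (crun_state p t).

Record objects_safe : Prop := {
  obj_agreement : forall p q k v w s t,
    responded p k v s -> responded q k w t -> v = w;
  obj_validity : forall p k v t, responded p k v t ->
    exists q s, s < t /\ proposed q k v s;
  obj_called : forall p k v t, responded p k v t ->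
    exists w s, s < t /\ proposed p k w s }.

Definition objects_live : Prop := forall p k v s,
  nonfaulty E p -> proposed p k v s -> exists w t, s < t /\ responded p k w t.

End CRun.

(* An algorithm solves [T] in the asynchronous system augmented with consensus
   objects: no timing assumption beyond the liveness of these objects. *)
Definition reducible_to_consensus (n f : nat) (In Out : Type)
    (T : task n In Out) : Prop :=
  exists (M V : countType) (R : cprotocol n M V In Out),
  forall (x : 'I_n -> In) (E : env n M) (resp : 'I_n -> nat -> seq (nat * V)),
    system E (csends R x E resp) f -> objects_safe R x E resp ->
    safe T x (coutput R x E resp) /\
    (objects_live R x E resp -> live E (coutput R x E resp)).

(* Main.v *)
(* Encoding messages injectively changes nothing in a run, so it is enough
   to implement consensus objects over some countable type of messages.
   This is done by a gossip version of multi-Paxos. Each agent keeps a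
   growing set of facts and broadcasts all of it at every step. Rounds
   play the role of ballots and are shared by all instances; round [r]
   belongs to agent [r %% n], which, once a majority has joined, leads the
   round with a log: the log of the highest earlier round it knows of,
   followed by all the proposals it knows. A log is chosen once a majority
   has voted in its round.

   Safety: the majorities of a chosen round [r'] and of the joins seen by
   a later leader meet, and since facts travel together with everything
   their author knew, this leader knows the log of round [r']. By
   induction, it extends it. Values are read off a log at the first entry
   of an instance, so all the chosen logs agree.

   Liveness: agents leave round [r] after [r] steps, or when they hear of
   a higher round. As agents step at most once per time unit, round [r]
   lasts longer than [r]; after GST and the last crash, a long enough
   round with a nonfaulty leader gets its log chosen. *)

Require Import Defs.
From HB Require Import structures.
From mathcomp Require Import all_boot zify.
From Stdlib Require Import FunctionalExtensionality.

Set Implicit Arguments.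
Unset Strict Implicit.
Unset Printing Implicit Defensive.

(** * Carrying messages through an encoding *)

Section Decode.
Variables (n : nat) (M M' : eqType) (enc : M -> M') (dec : M' -> option M).
Hypotheses (encK : pcancel enc dec) (decK : ocancel dec enc).

(** Messages that do not decode vanish from this view, so two protocols can share one channel, each
    seeing only its own traffic. *)
Definition env_decode (E : env n M') : env n M :=
  Env (crash E) (comm E) (fun p t => omap (decode_all dec) (sched E p t)).

(** [decK] keeps foreign messages from decoding to [m], so every event of the decoded view has a
    counterpart in the original one. *)
Lemma mem_decode_all (ms : seq ('I_n * M')) p m :
  ((p, m) \in decode_all dec ms) = ((p, enc m) \in ms).
Proof.
rewrite /decode_all mem_pmap; apply/mapP/idP => [[[q m'] mem_m'] | mem_m].
  move: (decK m') => /=; case: (dec m') => //= m1 eq_m' [-> ->].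
  by rewrite eq_m'.
by exists (p, enc m) => //=; rewrite encK.
Qed.

Lemma delivered_decode E p q m t :
  delivered (env_decode E) p q m t = delivered E p q (enc m) t.
Proof.
rewrite /delivered /=; case: (sched E q t) => //= ms.
exact: mem_decode_all.
Qed.

Section Sends.
Variables (E : env n M') (sends' : 'I_n -> nat -> seq ('I_n * M')).
Variable sends : 'I_n -> nat -> seq ('I_n * M).
Hypothesis sendsE : forall p t, sends p t = decode_all dec (sends' p t).

Lemma sent_decode p q m t : sent sends p q m t = sent sends' p q (enc m) t.
Proof. by rewrite /sent sendsE mem_decode_all. Qed.

Lemma system_decode f : system E sends' f -> system (env_decode E) sends f.
Proof.
case=> Hcs Hkr Hcb Hsym Hconn Hnc Hfl; split=> //.
- by move=> p c t /= Hc le_ct; rewrite (Hcs p c t).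
- move=> p t nfp; have [s le_ts ss] := Hkr p t nfp; exists s => //=.
  by case: (sched E p s) ss.
- move=> p q m t; rewrite delivered_decode => /Hnc[s lt_st ss].
  by exists s; rewrite ?sent_decode.
- move=> p q m nfq Hs t.
  have Hs' t0 : exists2 s, t0 <= s & sent sends' p q (enc m) s.
    by have [s le_s] := Hs t0; rewrite sent_decode; exists s.
  have [s le_ts ds] := Hfl p q _ nfq Hs' t; exists s => //.
  by rewrite delivered_decode.
Qed.

Lemma partially_synchronous_decode :
  partially_synchronous E sends' ->
  partially_synchronous (env_decode E) sends.
Proof.
case=> G [D H]; exists G, D => p q m s le_Gs stab.
rewrite sent_decode => /(H _ _ _ _ le_Gs stab)[t lt_t dt].
by exists t; rewrite ?delivered_decode.
Qed.

End Sends.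
End Decode.

Lemma decode_all_cat n (M M' : eqType) (dec : M' -> option M)
    (ms1 ms2 : seq ('I_n * M')) :
  decode_all dec (ms1 ++ ms2) = decode_all dec ms1 ++ decode_all dec ms2.
Proof. exact: pmap_cat. Qed.

Lemma decode_all_map n (M M' : eqType) (dec : M' -> option M) (enc : M -> M')
    (ms : seq ('I_n * M)) :
  pcancel enc dec -> decode_all dec [seq (d.1, enc d.2) | d <- ms] = ms.
Proof.
by move=> encK; rewrite /decode_all; elim: ms => //= -[p m] ms ->; rewrite encK.
Qed.

Lemma decode_all_map_None n (M M0 M' : eqType) (dec : M' -> option M)
    (e : M0 -> M') (ms : seq ('I_n * M0)) :
  (forall m, dec (e m) = None) ->
  decode_all dec [seq (d.1, e d.2) | d <- ms] = [::].
Proof.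
by move=> decN; rewrite /decode_all; elim: ms => //= d ms ->; rewrite decN.
Qed.

Section CarrySolves.
Variables (n : nat) (M M' : eqType) (enc : M -> M') (dec : M' -> option M).
Hypotheses (encK : pcancel enc dec) (decK : ocancel dec enc).
Variables (In Out : Type) (P : protocol n M In Out).

Lemma state_carry x E p t :
  state (carry enc dec P) x E p t = state P x (env_decode dec E) p t.
Proof. by elim: t => //= t ->; case: (sched E p t). Qed.

Lemma psends_carry x E p t :
  psends P x (env_decode dec E) p t =
  decode_all dec (psends (carry enc dec P) x E p t).
Proof.
rewrite /psends state_carry /=; case: (sched E p t) => //= ms.
by rewrite decode_all_map.
Qed.

Lemma carry_solves f (T : task n In Out) :
  solves f P T -> solves f (carry enc dec P) T.
Proof.
move=> solP x E sysE.
have outE : poutput (carry enc dec P) x E = poutput P x (env_decode dec E).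
  do 2 apply: functional_extensionality => ?.
  by rewrite /poutput state_carry.
have [safeT liveT] :=
  solP x _ (system_decode encK decK (psends_carry x E) sysE).
rewrite outE; split=> // ps; apply: liveT.
exact: partially_synchronous_decode (psends_carry x E) ps.
Qed.

End CarrySolves.

(** * Countable messages as muACP messages *)

Section Uacp.
Variables (M : countType) (B : seq tlv).

(** The code [pickle m] is written in unary, as the length of the payload. The option list is empty,
    which suits every [B]. *)
Definition uacp_enc (m : M) : uacp_msg B :=
  UacpMsg (Header 0 0 [::]) TELL [::] (nseq (pickle m) ord0).

(** Comparing with the re-encoding rejects messages that share only the payload length with an
    encoding; this gives [ocancel]. *)
Definition uacp_dec (u : uacp_msg B) : option M :=
  obind (fun m => if uacp_enc m == u then Some m else None)
    (pickle_inv (size (msg_payload u))).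

Lemma uacp_encK : pcancel uacp_enc uacp_dec.
Proof. by move=> m; rewrite /uacp_dec /= size_nseq pickleK_inv /= eqxx. Qed.

Lemma uacp_decK : ocancel uacp_dec uacp_enc.
Proof.
move=> u; rewrite /uacp_dec; case: (pickle_inv _) => //= m.
by case: eqP.
Qed.

End Uacp.

(** * Gossip multi-Paxos *)

Section Facts.
Variables (n : nat) (V : countType).

Definition log := seq (nat * V).

(** [Join] is the promise of Paxos and [Vote] the acceptance. A vote names no log because a round
    has at most one ([lead_unique]). *)
Inductive fact :=
  | Proposal of nat * V
  | Join of 'I_n & nat
  | Lead of nat & log
  | Vote of 'I_n & nat.

Definition fact_code (x : fact) :
    (nat * V) + ('I_n * nat) + (nat * log) + ('I_n * nat) :=
  match x with
  | Proposal c => inl (inl (inl c))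
  | Join p r => inl (inl (inr (p, r)))
  | Lead r A => inl (inr (r, A))
  | Vote p r => inr (p, r)
  end.

Definition code_fact
    (y : (nat * V) + ('I_n * nat) + (nat * log) + ('I_n * nat)) : fact :=
  match y with
  | inl (inl (inl c)) => Proposal c
  | inl (inl (inr c)) => Join c.1 c.2
  | inl (inr c) => Lead c.1 c.2
  | inr c => Vote c.1 c.2
  end.

Lemma fact_codeK : cancel fact_code code_fact. Proof. by case. Qed.

HB.instance Definition _ := Countable.copy fact (can_type fact_codeK).

Implicit Types (K : seq fact) (A : log) (r : nat).

Definition proposals K : log :=
  pmap (fun x => if x is Proposal c then Some c else None) K.
Definition leads K : seq (nat * log) :=
  pmap (fun x => if x is Lead r A then Some (r, A) else None) K.
Definition join_rounds K : seq nat :=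
  pmap (fun x => if x is Join _ r then Some r else None) K.
Definition joiners r K : {set 'I_n} := [set p | Join p r \in K].
Definition voters r K : {set 'I_n} := [set p | Vote p r \in K].
Definition quorum (S : {set 'I_n}) : bool := n < 2 * #|S|.

(* The first entry for [k] counts: extending a log keeps its values. *)
Definition lookup A (k : nat) : option V :=
  ohead [seq c.2 | c <- A & c.1 == k].

Definition max_lead (L : seq (nat * log)) : nat * log :=
  foldr (fun l b => if b.1 <= l.1 then l else b) (0, [::]) L.
(** What phase 1 of Paxos imposes on a leader; the default is the empty log, which imposes
    nothing. *)
Definition prior_log r K : log := (max_lead [seq l <- leads K | l.1 < r]).2.

Definition chosen_logs K : seq log :=
  [seq l.2 | l <- leads K & quorum (voters l.1 K)].
Definition learned (ks : seq nat) K : seq (nat * V) :=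
  pmap (fun kA => omap (pair kA.1) (lookup kA.2 kA.1))
    [seq (k, A) | k <- ks, A <- chosen_logs K].

Lemma mem_proposals c K : (c \in proposals K) = (Proposal c \in K).
Proof.
rewrite mem_pmap; apply/mapP/idP => [[[] //= c' Kc [->]] //|Kc].
by exists (Proposal c).
Qed.

Lemma mem_leads r A K : ((r, A) \in leads K) = (Lead r A \in K).
Proof.
rewrite mem_pmap; apply/mapP/idP => [[[] //= r' A' Kl [-> ->]] //|Kl].
by exists (Lead r A).
Qed.

Lemma mem_join_rounds r K :
  reflect (exists p, Join p r \in K) (r \in join_rounds K).
Proof.
rewrite mem_pmap; apply: (iffP mapP) => [[[] //= p r' Kj [->]]|[p Kj]].
  by exists p.
by exists (Join p r).
Qed.

Lemma max_leadP L l :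
  l \in L -> max_lead L \in L /\ l.1 <= (max_lead L).1.
Proof.
elim: L l => //= l0 L IH l; rewrite !inE.
case: leqP => [le_b|lt_b] /orP[/eqP->|Ll].
- by rewrite eqxx.
- by have [_ le_l] := IH l Ll; rewrite eqxx (leq_trans le_l).
(* The maximum of [L] exceeds [l0.1], so it is not the default of round [0], and [L] is nonempty. *)
- case: L IH lt_b => //= l1 L IH lt_b.
  by have [-> _] := IH l1 (mem_head _ _); rewrite orbT ltnW.
- by have [-> ->] := IH l Ll; rewrite orbT.
Qed.

Lemma prior_logP r K r' A :
  Lead r' A \in K -> r' < r ->
  exists2 r0, r' <= r0 < r & Lead r0 (prior_log r K) \in K.
Proof.
move=> KA lt_r.
have /max_leadP[]: (r', A) \in [seq l <- leads K | l.1 < r].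
  by rewrite mem_filter /= lt_r mem_leads.
rewrite mem_filter /prior_log; case: (max_lead _) => r0 A0 /=.
by rewrite mem_leads => /andP[lt_r0 KA0] le_r0; exists r0; rewrite ?le_r0.
Qed.

(** A prior log with an entry is not the default, so it stems from an actual round. *)
Lemma prior_log_mem r K c :
  c \in prior_log r K -> exists r0, Lead r0 (prior_log r K) \in K.
Proof.
case EL: [seq l <- leads K | l.1 < r] => [|[r0 A] L].
  by rewrite /prior_log EL.
have: (r0, A) \in [seq l <- leads K | l.1 < r] by rewrite EL mem_head.
rewrite mem_filter /= mem_leads => /andP[lt_r KA] _.
by have [r1 _ ?] := prior_logP KA lt_r; exists r1.
Qed.

Lemma lookup_cat A A' k v : lookup A k = Some v -> lookup (A ++ A') k = Some v.
Proof. by rewrite /lookup filter_cat map_cat; case: [seq _ | _ <- _ & _]. Qed.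

Lemma lookup_mem A k v : lookup A k = Some v -> (k, v) \in A.
Proof.
rewrite /lookup; elim: A => //= -[k' v'] A IH /=.
case: eqP => [-> [->]|_ /IH]; first exact: mem_head.
by rewrite inE orbC => ->.
Qed.

Lemma lookup_some A k v : (k, v) \in A -> exists w, lookup A k = Some w.
Proof.
rewrite /lookup; elim: A => //= -[k' v'] A IH /=.
by case: eqP => [_ _|ne]; [exists v' | rewrite inE => /predU1P[[] /esym|/IH]].
Qed.

Lemma chosen_logsP A K :
  reflect (exists2 r, Lead r A \in K & quorum (voters r K))
    (A \in chosen_logs K).
Proof.
apply: (iffP mapP) => [[[r A'] /=]|[r KA Q]].
  by rewrite mem_filter mem_leads => /andP[Q KA] ->; exists r.
by exists (r, A); rewrite // mem_filter mem_leads Q.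
Qed.

Lemma learnedP ks K k v :
  reflect (k \in ks /\ exists2 A, A \in chosen_logs K & lookup A k = Some v)
    ((k, v) \in learned ks K).
Proof.
rewrite mem_pmap; apply: (iffP mapP) => [[[k' A]]|[ksk [A cA lA]]].
  case/allpairsP=> -[k1 A1] /= [ks1 cA1 [-> ->]].
  case E: lookup => [w|] //= [-> ->].
  by split=> //; exists A1.
by exists (k, A); rewrite /= ?lA //; apply/allpairsP; exists (k, A).
Qed.

Lemma quorumS (S S' : {set 'I_n}) : S \subset S' -> quorum S -> quorum S'.
Proof.
by move=> sSS' /leq_trans; apply; rewrite leq_mul2l subset_leq_card.
Qed.

Lemma quorumI (S S' : {set 'I_n}) :
  quorum S -> quorum S' -> exists2 p, p \in S & p \in S'.
Proof.
rewrite /quorum => qS qS'.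
have [e|[p]] := set_0Vmem (S :&: S'); last by case/setIP; exists p.
have: #|S :|: S'| <= n by rewrite -[X in _ <= X]card_ord max_card.
by have := cardsUI S S'; rewrite e cards0; lia.
Qed.

(** * The local step of an agent *)

Record paxos_state := PaxosState {
  known : seq fact; round : nat; clock : nat }.

Definition paxos_init := PaxosState [::] 0 0.

Section Step.
Variables (p : 'I_n) (s : paxos_state) (ms : seq ('I_n * seq fact)) (ins : log).

Definition heard : seq fact :=
  undup (known s ++ flatten [seq m.2 | m <- ms]).
(** The test [round s <= clock s], read as 0 or 1, is the time-out: [clock] counts the steps made in
    the current round since entering it. *)
Definition next_round : nat :=
  maxn (\max_(r <- join_rounds heard) r) (round s + (round s <= clock s)).
Definition next_clock : nat :=
  if next_round == round s then (clock s).+1 else 0.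
(** Knowledge grows in layers within a step, so that an agent's own join counts for its quorum and
    it can vote at once for its own log. *)
Definition joined : seq fact := Join p next_round :: heard.
(** The last test keeps a leader, which remembers its own logs, from leading a round twice. *)
Definition may_lead : bool :=
  [&& p == next_round %% n :> nat, quorum (joiners next_round joined)
    & next_round \notin [seq l.1 | l <- leads joined]].
Definition new_log : log := prior_log next_round joined ++ proposals joined.
Definition led : seq fact :=
  if may_lead then Lead next_round new_log :: joined else joined.
Definition voted : seq fact :=
  if next_round \in [seq l.1 | l <- leads led] then Vote p next_round :: led
  else led.

Definition paxos_step : paxos_state :=
  PaxosState (map Proposal ins ++ voted) next_round next_clock.

(** The justification for creating a fact in this step; the invariants of runs are read off from it
    through [fact_origin]. *)
Definition fresh (x : fact) : Prop :=
  match x with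
  | Proposal c => c \in ins
  | Join q r => q = p /\ r = next_round
  | Lead r A => [/\ r = next_round, A = new_log & may_lead]
  | Vote q r => [/\ q = p, r = next_round
                   & exists A, Lead r A \in known paxos_step]
  end.

Lemma has_leadP r K :
  reflect (exists A, Lead r A \in K) (r \in [seq l.1 | l <- leads K]).
Proof.
apply: (iffP mapP) => [[[r' A]]|[A KA]].
  by rewrite mem_leads /= => KA ->; exists A.
by exists (r, A); rewrite ?mem_leads.
Qed.

Lemma joined_led : {subset joined <= led}.
Proof.
by move=> x; rewrite /led; case: ifP => // _ jx; rewrite in_cons jx orbT.
Qed.

Lemma led_known : {subset led <= known paxos_step}.
Proof.
move=> x lx; rewrite mem_cat /voted.
by case: ifP => _; rewrite ?inE lx !orbT.
Qed.

Lemma joined_known : {subset joined <= known paxos_step}.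
Proof. by move=> x /joined_led/led_known. Qed.

Lemma heard_known : {subset heard <= known paxos_step}.
Proof. by move=> x hx; apply: joined_known; rewrite inE hx orbT. Qed.

Lemma known_heard : {subset known s <= heard}.
Proof. by move=> x sx; rewrite mem_undup mem_cat sx. Qed.

Lemma received_heard q K : (q, K) \in ms -> {subset K <= heard}.
Proof.
move=> msK x Kx; rewrite mem_undup mem_cat orbC; apply/orP; left.
by apply/flattenP; exists K => //; apply/mapP; exists (q, K).
Qed.

Lemma heardP x :
  x \in heard -> x \in known s \/ exists q K, (q, K) \in ms /\ x \in K.
Proof.
rewrite mem_undup mem_cat => /orP[|/flattenP[K /mapP[[q K'] msK /= ->] Kx]].
  by left.
by right; exists q, K'.
Qed.

Lemma proposal_known c : c \in ins -> Proposal c \in known paxos_step.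
Proof. by move=> ic; rewrite mem_cat map_f. Qed.

Lemma join_next : Join p next_round \in known paxos_step.
Proof. by apply: joined_known; rewrite mem_head. Qed.

Lemma vote_next A :
  Lead next_round A \in known paxos_step ->
  Vote p next_round \in known paxos_step.
Proof.
rewrite !mem_cat => /orP[/mapP[]//|]; rewrite /voted.
case: ifP => [|/negP no]; first by rewrite mem_head orbT.
by move=> lA; case: no; apply/has_leadP; exists A.
Qed.

Lemma fresh_known x : x \in known paxos_step -> x \in heard \/ fresh x.
Proof.
move=> kx; have kx' := kx.
move: kx; rewrite mem_cat => /orP[/mapP[c ic ->]|]; first by right.
have led_fresh y : y \in led -> y \in heard \/ fresh y.
  have joined_fresh z : z \in joined -> z \in heard \/ fresh z.
    by rewrite inE => /predU1P[->|]; [right | left].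
  rewrite /led; case: ifP => [ml|_]; last exact: joined_fresh.
  by rewrite inE => /predU1P[->|]; [right | apply: joined_fresh].
rewrite /voted; case: ifP => [/has_leadP[A lA]|_]; last exact: led_fresh.
rewrite inE => /predU1P[->|]; last exact: led_fresh.
by right; split=> //; exists A; apply: led_known.
Qed.

Lemma round_next : round s <= next_round.
Proof. by rewrite leq_max leq_addr orbT. Qed.

Lemma join_heard_next q r : Join q r \in heard -> r <= next_round.
Proof.
move=> hj; rewrite leq_max; apply/orP; left.
by apply: (@bigmaxn_sup_seq _ _ r) => //; apply/mem_join_rounds; exists q.
Qed.

(** Under these hypotheses [may_lead] can fail only because a log of the round is known already. *)
Lemma lead_next :
  p = next_round %% n :> nat ->
  quorum (joiners next_round (known s)) ->
  exists A, Lead next_round A \in known paxos_step.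
Proof.
move=> lp Q; have [ml|] := boolP may_lead.
  by exists new_log; apply: led_known; rewrite /led ml mem_head.
rewrite /may_lead lp eqxx /= negb_and negbK => /orP[/negP[]|/has_leadP[A jA]].
  apply: quorumS Q; apply/subsetP => q; rewrite !inE => /known_heard ->.
  by rewrite orbT.
by exists A; apply: joined_known.
Qed.

End Step.
End Facts.

Arguments Proposal {n V} c.
Arguments Join {n V} p r.
Arguments Lead {n V} r A.
Arguments Vote {n V} p r.
Arguments paxos_init {n V}.

(** * Safety *)

Section PaxosRun.
Variables (n : nat) (V : countType) (E : env n (seq (fact n V))).
Variable ins : 'I_n -> nat -> log V.

(** Proposals enter as an arbitrary stream [ins], which makes the analysis independent of the client
    algorithm. *)
Fixpoint pax (p : 'I_n) (t : nat) : paxos_state n V :=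
  if t is t'.+1 then
    if sched E p t' is Some ms then paxos_step p (pax p t') ms (ins p t')
    else pax p t'
  else paxos_init.

Definition knows p t := known (pax p t).
Definition rnd p t := round (pax p t).

Definition paxos_sends (p : 'I_n) (t : nat) : seq ('I_n * seq (fact n V)) :=
  if sched E p t is Some ms then [seq (q, knows p t.+1) | q <- enum 'I_n]
  else [::].

Lemma paxos_sentP p q m t :
  reflect (isSome (sched E p t) /\ m = knows p t.+1) (sent paxos_sends p q m t).
Proof.
rewrite /sent /paxos_sends; case: (sched E p t) => [ms|]; last first.
  by apply: (iffP idP) => // -[].
apply: (iffP mapP) => [[q' _ [_ ->]] //|[_ ->]].
by exists q; rewrite ?mem_enum.
Qed.

Lemma pax_step p t ms : sched E p t = Some ms ->
  pax p t.+1 = paxos_step p (pax p t) ms (ins p t).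
Proof. by move=> /= ->. Qed.

Lemma pax_idle p t : sched E p t = None -> pax p t.+1 = pax p t.
Proof. by move=> /= ->. Qed.

Lemma rnd_mono p s t : s <= t -> rnd p s <= rnd p t.
Proof.
apply: (@homo_leq _ (rnd p) leq) => // [? ? ? /leq_trans|i]; first exact.
rewrite /rnd /=; case: (sched E p i) => // ms; exact: round_next.
Qed.

Lemma knows_mono p s t : s <= t -> {subset knows p s <= knows p t}.
Proof.
elim: t => [|t IH]; first by rewrite leqn0 => /eqP->.
rewrite leq_eqVlt ltnS => /predU1P[-> //|/IH sub] x /sub.
rewrite /knows /=; case: (sched E p t) => // ms kx.
by apply: heard_known; apply: known_heard.
Qed.

Lemma delivered_knows p q m t :
  delivered E p q m t -> {subset m <= knows q t.+1}.
Proof.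
rewrite /delivered /knows /=; case: (sched E q t) => //= ms msm x mx.
by apply: heard_known; apply: (received_heard _ msm).
Qed.

(** Every step joins its round; [0 < rnd p t] sets aside the initial state, where nothing is joined
    yet. *)
Lemma join_current p t : 0 < rnd p t -> Join p (rnd p t) \in knows p t.
Proof.
rewrite /rnd /knows; elim: t => //= t IH.
by case: (sched E p t) => //= ms _; apply: join_next.
Qed.

Lemma vote_current p t A :
  Lead (rnd p t) A \in knows p t -> Vote p (rnd p t) \in knows p t.
Proof.
rewrite /rnd /knows; elim: t => //= t IH.
by case: (sched E p t) => // ms; apply: vote_next.
Qed.

Hypothesis no_create : forall p q m t, delivered E p q m t ->
  exists2 s, s < t & sent paxos_sends p q m s.

(** A received message is the whole knowledge of its sender right after an earlier step, whence the
    inclusion. *)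
Lemma heard_origin p t ms x : sched E p t = Some ms ->
  x \in heard (pax p t) ms ->
  exists q s, [/\ s <= t, {subset knows q s <= heard (pax p t) ms}
                & x \in knows q s].
Proof.
move=> Et /heardP[kx|[q [K [msK Kx]]]].
  by exists p, t; split=> // y; apply: known_heard.
have /no_create[s lt_st /paxos_sentP[_ EK]]: delivered E q p K t.
  by rewrite /delivered Et.
exists q, s.+1; split=> //; rewrite -EK //.
exact: received_heard msK.
Qed.

(* Messages are whole knowledge sets, so whoever knows a fact knows everything
   that its author knew on creating it. *)
Lemma fact_origin q t x : x \in knows q t ->
  exists p s ms, [/\ s < t, sched E p s = Some ms,
    fresh p (pax p s) ms (ins p s) x & {subset knows p s.+1 <= knows q t}].
Proof.
elim/ltn_ind: t q => -[//|t] IH q.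
rewrite {1}/knows /=; case Et: (sched E q t) => [ms|]; last first.
  move=> /(IH t (ltnSn t))[p [s [ms [lt_st Es fx sub]]]].
  exists p, s, ms; split=> // [|y /sub]; first exact: leqW.
  exact: knows_mono.
case/fresh_known => [|fx]; last by exists q, t, ms; split.
move=> /(heard_origin Et)[p [s [le_st sub_h kx]]].
have [p' [s' [ms' [lt_s' Es' fx sub]]]] := IH s le_st p kx.
exists p', s', ms'; split=> // [|y /sub/sub_h]; first by lia.
by rewrite /knows (pax_step Et); apply: heard_known.
Qed.

Lemma join_origin p q r t : Join p r \in knows q t ->
  exists s, [/\ s <= t, rnd p s = r & {subset knows p s <= knows q t}].
Proof.
case/fact_origin => p' [s [ms [lt_st Es [-> ->] sub]]].
by exists s.+1; split=> //; rewrite /rnd (pax_step Es).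
Qed.

Lemma vote_origin p q r t : Vote p r \in knows q t ->
  exists s, rnd p s = r /\ exists A, Lead r A \in knows p s.
Proof.
case/fact_origin => p' [s [ms [lt_st Es [-> -> [A kA]] sub]]].
by exists s.+1; rewrite /rnd /knows (pax_step Es); split=> //; exists A.
Qed.

(* An agent never votes below the round it has joined: all its earlier votes,
   and the logs it voted for, are known to whoever knows that it has joined. *)
Lemma join_vote_lead p q q' r r' t t' :
  Join p r \in knows q t -> Vote p r' \in knows q' t' -> r' < r ->
  exists A, Lead r' A \in knows q t.
Proof.
move=> /join_origin[s [_ rs sub]] /vote_origin[s' [rs' [A kA]]] lt_r.
exists A; apply: sub; apply: knows_mono kA.
by case: (leqP s' s) => // /ltnW/(rnd_mono p); lia.
Qed.

Lemma lead_origin q t r A : Lead r A \in knows q t ->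
  exists p s ms, [/\ s < t, sched E p s = Some ms, rnd p s.+1 = r,
    A = new_log p (pax p s) ms & may_lead p (pax p s) ms].
Proof.
case/fact_origin => p [s [ms [lt_st Es [-> -> ml] _]]].
by exists p, s, ms; split=> //; rewrite /rnd (pax_step Es).
Qed.

Lemma step_rnd p t ms :
  sched E p t = Some ms -> next_round (pax p t) ms = rnd p t.+1.
Proof. by move=> Et; rewrite /rnd (pax_step Et). Qed.

Lemma joined_knows p t ms : sched E p t = Some ms ->
  {subset joined p (pax p t) ms <= knows p t.+1}.
Proof. by move=> Et; rewrite /knows (pax_step Et); apply: joined_known. Qed.

(** The leader is fixed by [r %% n] and leads the round in one step only, so every log of round [r]
    stems from the given step. *)
Lemma lead_leader q t r A p s ms : Lead r A \in knows q t ->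
  sched E p s = Some ms -> rnd p s.+1 = r -> may_lead p (pax p s) ms ->
  A = new_log p (pax p s) ms.
Proof.
move=> kA Es rs ml; have [p' [s' [ms' [_ Es' rs' eA ml']]]] := lead_origin kA.
have eqp : p' = p.
  case/and3P: ml => /eqP lp _ _; case/and3P: ml' => /eqP lp' _ _.
  by apply: val_inj; rewrite /= lp lp' (step_rnd Es) (step_rnd Es') rs rs'.
(* A later leading step in the same round would find the first log in [joined], against
   [may_lead]. *)
have once u ms1 u' ms2 : sched E p u = Some ms1 -> sched E p u' = Some ms2 ->
    rnd p u.+1 = r -> rnd p u'.+1 = r ->
    may_lead p (pax p u) ms1 -> may_lead p (pax p u') ms2 -> u' <= u.
  move=> Eu Eu' ru ru' mlu mlu'; rewrite leqNgt; apply/negP => lt_u.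
  case/and3P: (mlu') => _ _; rewrite (step_rnd Eu') => /negP[].
  apply/has_leadP; exists (new_log p (pax p u) ms1).
  rewrite in_cons; apply/orP; right; apply: known_heard.
  apply: (knows_mono lt_u); rewrite /knows (pax_step Eu); apply: led_known.
  by rewrite /led mlu ru' -ru -(step_rnd Eu) mem_head.
move: eA rs' Es' ml'; rewrite eqp => eA rs' Es' ml'.
have es : s = s'.
  by apply/eqP; rewrite eqn_leq (once s' ms' s ms) // (once s ms s' ms').
by move: Es' eA; rewrite -es Es => -[->].
Qed.

Lemma lead_unique q t q' t' r A A' :
  Lead r A \in knows q t -> Lead r A' \in knows q' t' -> A = A'.
Proof.
move=> kA /lead_origin[p [s [ms [_ Es rs -> ml]]]].
exact: lead_leader kA Es rs ml.
Qed.

Lemma chosen_prefix q1 q2 q3 t1 t2 t3 r r' A A' :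
  Lead r A \in knows q1 t1 -> Lead r' A' \in knows q2 t2 ->
  quorum (voters r' (knows q3 t3)) -> r' <= r -> prefix A' A.
Proof.
elim/ltn_ind: r q1 t1 A => r IH q1 t1 A kA kA' Q.
rewrite leq_eqVlt => /predU1P[er|lt_r].
  by rewrite -er in kA; rewrite (lead_unique kA kA') prefix_refl.
have [p [s [ms [_ Es rs -> ml]]]] := lead_origin kA.
have eqr := step_rnd Es; rewrite rs in eqr.
(* Some [q] both joined [r], as the leader saw, and voted in [r']; its join carries the log of [r']
   along. *)
have [A2 jA2] : exists A2, Lead r' A2 \in joined p (pax p s) ms.
  case/and3P: ml => _ Qj _; have [q] := quorumI Qj Q; rewrite !inE eqr.
  case/predU1P=> [[eq_q]|hj].
    (* Here [q] is the leader itself, joining in this very step. The log found after the step was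
       not created by it, as it would then be of round [r]. *)
    move=> vq; have kj : Join p r \in knows p s.+1.
      by apply: (joined_knows Es); rewrite inE eqr eqxx.
    rewrite eq_q in vq.
    have [A2 kA2] := join_vote_lead kj vq lt_r.
    exists A2; move: kA2; rewrite /knows (pax_step Es) => /fresh_known[].
    - by rewrite inE orbC => ->.
    - by case=> er' _ _; rewrite er' eqr ltnn in lt_r.
  move=> vq; have [q' [u [_ sub kj]]] := heard_origin Es hj.
  have [A2 /sub kA2] := join_vote_lead kj vq lt_r.
  by exists A2; rewrite inE kA2 orbT.
(* The new log extends the prior one, of a round [r0] with [r' <= r0 < r], to which the induction
   hypothesis applies. *)
have [r0 /andP[le_r0 lt_r0] kA0] := prior_logP jA2 lt_r.
rewrite /new_log eqr; apply: prefix_catl.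
exact: IH lt_r0 _ _ _ (joined_knows Es kA0) kA' Q le_r0.
Qed.

Lemma learned_agree p q ks ks' k v w s t :
  (k, v) \in learned ks (knows p s) -> (k, w) \in learned ks' (knows q t) ->
  v = w.
Proof.
move=> /learnedP[_ [A /chosen_logsP[r kA Q] lA]].
move=> /learnedP[_ [A' /chosen_logsP[r' kA' Q'] lA']].
case/orP: (leq_total r r') => le_r.
  have /prefixP[B eA'] := chosen_prefix kA' kA Q le_r.
  by apply: Some_inj; rewrite -lA' eA' (lookup_cat _ lA).
have /prefixP[B eA] := chosen_prefix kA kA' Q' le_r.
by apply: Some_inj; rewrite -lA eA (lookup_cat _ lA').
Qed.

(** * Validity of learned values *)

Definition proposed_before t (c : nat * V) : Prop :=
  exists q s, [/\ s < t, isSome (sched E q s) & c \in ins q s].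

Lemma proposed_beforeW s t c :
  s <= t -> proposed_before s c -> proposed_before t c.
Proof. by move=> le_st [q [u [lt_u ? ?]]]; exists q, u; split=> //; lia. Qed.

Lemma proposal_proposed q t c : Proposal c \in knows q t -> proposed_before t c.
Proof.
case/fact_origin => p [s [ms [lt_st Es ic _]]].
by exists p, s; rewrite Es.
Qed.

(** Induction on time: an entry of a new log comes from a known proposal or from a log known
    earlier. *)
Lemma lead_proposed q t r A c :
  Lead r A \in knows q t -> c \in A -> proposed_before t c.
Proof.
elim/ltn_ind: t q r A => t IH q r A /lead_origin[p [s [ms [lt_st Es _ -> _]]]].
have joined_le x : x \in joined p (pax p s) ms ->
    (if x is Join _ _ then False else True) ->
    exists q' u, u <= s /\ x \in knows q' u.
  rewrite inE => /predU1P[-> //|/(heard_origin Es)[q' [u [le_us _ kx]]]] _.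
  by exists q', u.
rewrite mem_cat => /orP[cA|].
  have [r0 /joined_le[//|q' [u [le_us kA]]]] := prior_log_mem cA.
  have lt_ut : u < t by apply: leq_ltn_trans lt_st.
  exact: proposed_beforeW (ltnW lt_ut) (IH u lt_ut _ _ _ kA cA).
rewrite mem_proposals => /joined_le[//|q' [u [le_us /proposal_proposed]]].
by apply: proposed_beforeW; lia.
Qed.

Lemma learned_proposed p t ks k v :
  (k, v) \in learned ks (knows p t) -> proposed_before t (k, v).
Proof.
case/learnedP=> _ [A /chosen_logsP[r kA _] /lookup_mem].
exact: lead_proposed kA.
Qed.

End PaxosRun.

(** * Liveness *)

Section PaxosLiveness.
Variables (n f : nat) (V : countType) (E : env n (seq (fact n V))).
Variable ins : 'I_n -> nat -> log V.
Hypotheses (majority : 2 * f < n) (sysE : system E (paxos_sends E ins) f).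

Local Notation pax := (pax E ins).
Local Notation knows := (knows E ins).
Local Notation rnd := (rnd E ins).

(** An agent moves up to the rounds it hears of in the same step. *)
Lemma join_rnd p q r t : Join p r \in knows q t -> r <= rnd q t.
Proof.
elim: t => // t IH; case Et: (sched E q t) => [ms|]; last first.
  by rewrite /knows /rnd (pax_idle _ Et).
rewrite /knows (pax_step _ Et) => /fresh_known; rewrite -(step_rnd _ Et).
by case=> [/join_heard_next|[_ ->]].
Qed.

(** The clock gains at most one per time unit, so its value bounds from below how long ago the
    current round was entered. *)
Lemma clockP p t :
  clock (pax p t) <= t /\ rnd p t <= rnd p (t - clock (pax p t)).
Proof.
elim: t => // t [le_ct le_r]; case Et: (sched E p t) => [ms|]; last first.
  rewrite /rnd (pax_idle _ Et); split; first exact: leqW.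
  by apply: leq_trans le_r _; apply: rnd_mono; lia.
rewrite (pax_step _ Et) -(step_rnd _ Et) /= /next_clock.
by case: eqP => [->|_]; rewrite ?subn0 ?(step_rnd _ Et) ?subSS.
Qed.

Lemma next_step p t : nonfaulty E p ->
  exists s ms, [/\ t <= s, sched E p s = Some ms & pax p s = pax p t].
Proof.
move=> nfp; have [s le_ts] := keeps_running sysE t nfp.
rewrite -(subnKC le_ts); move: (s - t) => d {s le_ts}; elim: d t => [|d IH] t.
  by rewrite addn0; case Et: (sched E p t) => [ms|] // _; exists t, ms.
case Et: (sched E p t) => [ms|]; first by exists t, ms.
rewrite addnS -addSn => /IH[u [ms [lt_tu Eu eq_pax]]].
by exists u, ms; split=> //; [lia | rewrite eq_pax (pax_idle _ Et)].
Qed.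

Lemma rnd_increases p t : nonfaulty E p -> exists t', rnd p t < rnd p t'.
Proof.
(* Induction on the number of steps left before the time-out. *)
move=> nfp; have [m] := ubnPleq (rnd p t - clock (pax p t)).
elim: m t => [|m IH] t le_m;
  have [s [ms [le_ts Es eq_pax]]] := next_step t nfp.
all: have le_next := round_next (pax p s) ms.
all: have eq_next := step_rnd ins Es.
all: have eq_s : rnd p s = rnd p t by rewrite /rnd eq_pax.
  exists s.+1; rewrite -eq_next leq_max; apply/orP; right.
  by rewrite eq_pax -/(rnd p t); move: le_m; rewrite /rnd; case: leqP; lia.
have [lt_r|le_r] := ltnP (rnd p t) (rnd p s.+1); first by exists s.+1.
have eq_r : rnd p s.+1 = rnd p t.
  by apply/eqP; rewrite eqn_leq le_r -eq_s rnd_mono.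
have [|t' lt_t'] := IH s.+1; last by exists t'; rewrite -eq_r.
rewrite eq_r (pax_step _ Es) /= /next_clock eq_next eq_r -eq_s eqxx eq_pax.
by rewrite eq_s; lia.
Qed.

Lemma rnd_unbounded p r : nonfaulty E p -> exists t, r <= rnd p t.
Proof.
move=> nfp; elim: r => [|r [t le_r]]; first by exists 0.
by have [t' lt_r] := rnd_increases t nfp; exists t'; apply: leq_ltn_trans lt_r.
Qed.

Definition first_time r t : Prop :=
  (exists p, r <= rnd p t) /\ (forall q s, s < t -> rnd q s < r).

Lemma first_timeP p r : nonfaulty E p -> exists t, first_time r t.
Proof.
move=> nfp; have: exists t, [exists q, r <= rnd q t].
  have [t le_r] := rnd_unbounded r nfp.
  by exists t; apply/existsP; exists p.
case/ex_minnP=> t /existsP[q le_r] min_t; exists t; split; first by exists q.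
move=> q' s; apply: contraTltn => le_r'; rewrite -leqNgt.
by apply: min_t; apply/existsP; exists q'.
Qed.

(* The first agent to enter round [r.+1] does so by timeout, after [r] steps in
   round [r]. *)
Lemma round_lasts r t t' : first_time r t -> first_time r.+1 t' -> t + r < t'.
Proof.
move=> [_ before_r] [[p lt_r] before_r1].
case: t' lt_r before_r1 => // t' lt_r H.
have lt_t' q s : s <= t' -> rnd q s <= r by move=> /(H q).
have [le_ct le_rc] := clockP p t'.
case Et: (sched E p t') lt_r => [ms|]; last first.
  by rewrite /rnd (pax_idle _ Et) -/(rnd p t') ltnNge lt_t'.
rewrite -(step_rnd _ Et) /next_round leq_max => /orP[].
  (* A round heard of was entered by its joiner at some time up to [t'], so it is at most [r]. *)
  rewrite ltnNge => /negP[].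
  apply/bigmax_leqP_seq => r' /mem_join_rounds[q hj] _.
  have [q' [s [le_s _ kj]]] := heard_origin (no_creation sysE) Et hj.
  have [u [le_us <- _]] := join_origin (no_creation sysE) kj.
  by apply: lt_t'; lia.
have := lt_t' p t' (leqnn _); rewrite /rnd in le_rc *; move=> le_r lt_r.
(* What remains is the time-out, with [r <= clock]; and round [r] was already reached [clock] time
   units ago, hence not before [t]. *)
have le_t : t <= t' - clock (pax p t').
  rewrite leqNgt; apply/negP => /(before_r p); rewrite /rnd.
  by move: lt_r; case: (round (pax p t') <= _) => /=; lia.
by move: lt_r; case: leqP => /=; lia.
Qed.

Lemma nonfaulty_quorum : quorum [set p | nonfaulty E p].
Proof.
have le_f := crash_bound sysE; have := cardsC [set p | ~~ nonfaulty E p].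
have -> : ~: [set p | ~~ nonfaulty E p] = [set p | nonfaulty E p].
  by apply/setP=> p; rewrite !inE negbK.
rewrite card_ord /quorum; move: le_f majority; set a := #|_|; set c := #|_|.
lia.
Qed.

(** * Progress after stabilization *)

Section Timely.
Variables GST D : nat.
Hypothesis timely : forall p q m s,
  GST <= s -> stable_channel E p q -> sent (paxos_sends E ins) p q m s ->
  exists2 t, s < t <= s + D & delivered E p q m t.

Lemma broadcast_timely p q s : nonfaulty E p -> nonfaulty E q -> GST <= s ->
  isSome (sched E p s) ->
  exists2 t, s < t <= s + D & delivered E p q (knows p s.+1) t.
Proof.
move=> nfp nfq le_s Es; apply: timely => //; last exact/paxos_sentP.
by rewrite /stable_channel nfp nfq; apply: comm_connected sysE _ _ nfp nfq.
Qed.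

(* Every agent sends to itself, hence is woken up once every [D] time units. *)
Lemma steps_timely : exists2 T, GST <= T &
  forall p t, nonfaulty E p -> T <= t ->
  exists2 s, t < s <= t + D & isSome (sched E p s).
Proof.
have: forall p, exists s, nonfaulty E p -> GST <= s /\ isSome (sched E p s).
  move=> p; have [nfp|] := boolP (nonfaulty E p); last by exists 0.
  by have [s] := keeps_running sysE GST nfp; exists s.
case/fin_all_exists => s0 Hs0; exists (maxn GST (\max_p s0 p)).
  exact: leq_maxl.
move=> p t nfp; rewrite geq_max => /andP[_ /(leq_trans (leq_bigmax p))].
have [le_G E0] := Hs0 p nfp.
have again s : GST <= s -> isSome (sched E p s) ->
    exists2 u, s < u <= s + D & isSome (sched E p u).
  move=> le_s Es; have [u le_u du] := broadcast_timely nfp nfp le_s Es.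
  by exists u => //; move: du; rewrite /delivered; case: (sched E p u).
elim: t => [|t IH]; first by rewrite leqn0 => /eqP<-; exact: again.
rewrite leq_eqVlt => /predU1P[<-|]; first exact: again.
rewrite ltnS => le_t; have [s /andP[lt_s le_s] Es] := IH le_t.
have [lt_s'|le_s'] := ltnP t.+1 s; first by exists s => //; lia.
have es : s = t.+1 by lia.
by rewrite -es; apply: again => //; lia.
Qed.

(** At most [D] until the next step of the sender, at most [D] for delivery, and one more unit for
    the receiving step to take effect. *)
Let W := (2 * D).+1.

Lemma spread : exists T, forall p q t,
  nonfaulty E p -> nonfaulty E q -> T <= t ->
  {subset knows p t <= knows q (t + W)} /\
  exists2 s, t <= s < t + W & isSome (sched E p s).
Proof.
have [T le_T stepT] := steps_timely; exists T => // p q t nfp nfq le_t.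
have [s /andP[lt_s le_s] Es] := stepT p t nfp le_t; split.
  move=> x /(knows_mono (leqW (ltnW lt_s))) kx.
  have [|u /andP[lt_u le_u] dl] := broadcast_timely nfp nfq _ Es; first lia.
  have := delivered_knows ins dl kx; apply: knows_mono; rewrite /W; lia.
by exists s => //; rewrite /W; lia.
Qed.

(** Past the last crash time, a late round can only be opened by an agent that stays alive to spread
    the news. *)
Lemma quiescence : exists T, forall p t,
  T <= t -> isSome (sched E p t) -> nonfaulty E p.
Proof.
exists (\max_p odflt 0 (crash E p)) => p t /(leq_trans (leq_bigmax p)).
rewrite /nonfaulty; case Ec: (crash E p) => [c|] //= le_c.
by rewrite (crash_stop sysE Ec le_c).
Qed.

(* The proposer [p] itself leads a late round, which is long enough for what a
   decision takes: everybody joins, the joins reach [p], [p] leads, its log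
   reaches everybody, the votes reach [p]. *)
Lemma proposal_learned p s k v : nonfaulty E p -> isSome (sched E p s) ->
  (k, v) \in ins p s ->
  exists t0 w, forall ks t, k \in ks -> t0 <= t ->
    (k, w) \in learned ks (knows p t).
Proof.
move=> nfp Es ic.
have [T0 spreadT] := spread; have [Tc quiet] := quiescence.
pose T := maxn (maxn T0 Tc) s.+1.
(* Rounds from [b] on start after [T] and last more than [4 * W]. *)
have [b max_b W_b] : exists2 b, forall q, rnd q T < b & 4 * W < b.
  exists (\max_q rnd q T + 4 * W).+1 => [q|]; last by rewrite ltnS leq_addl.
  by rewrite ltnS; apply: leq_trans (leq_addr _ _); apply: (bigmax_sup q).
(* A round from [b] on that belongs to [p]. *)
have [r le_br lead_p] : exists2 r, b <= r & p = r %% n :> nat.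
  exists (b * n + p); last by rewrite modnMDl modn_small.
  apply: leq_trans (leq_addr _ _); apply: leq_pmulr.
  exact: leq_ltn_trans (ltn_ord p).
have [t ft] := first_timeP r nfp; have [t' ft'] := first_timeP r.+1 nfp.
have lasts := round_lasts ft ft'.
have lt_T : T < t.
  case: ft => -[q le_r] _; rewrite ltnNge; apply/negP => /(rnd_mono E ins q).
  by have := max_b q; lia.
have le_T0 : T0 <= t by rewrite /T in lt_T; lia.
have rnd_le q u : u <= t + 4 * W -> rnd q u <= r.
  by move=> le_u; case: ft' => _ /(_ q u); rewrite ltnS; apply; lia.
(* Whoever opens round [r] steps at [t.-1], after the last crash, so it is nonfaulty. *)
have [p0 nfp0 kj0] : exists2 p0, nonfaulty E p0 & Join p0 r \in knows p0 t.
  case: ft => -[p0 le_r] before; exists p0.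
    have t_gt0 : 0 < t by lia.
    rewrite -(prednK t_gt0) in le_r; have := before p0 t.-1.
    rewrite prednK // => /(_ (leqnn _)).
    case Ep: (sched E p0 t.-1) => [ms|]; last first.
      by move: le_r; rewrite /rnd (pax_idle _ Ep); lia.
    by move=> _; apply: (quiet _ t.-1); rewrite ?Ep // /T in lt_T *; lia.
  have <- : rnd p0 t = r by apply/eqP; rewrite eqn_leq le_r rnd_le //; lia.
  by apply: join_current; lia.
have sp q q' u x : nonfaulty E q -> nonfaulty E q' -> t <= u ->
    x \in knows q u -> x \in knows q' (u + W).
  move=> nfq nfq' le_u; have [|sub _] := spreadT q q' u nfq nfq'; first by lia.
  exact: sub.
(* The join of [p0] has reached every nonfaulty agent by [t + W], and nobody leaves the round before
   [t + 4 * W]. *)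
have in_r q u : nonfaulty E q -> t + W <= u <= t + 4 * W -> rnd q u = r.
  move=> nfq /andP[le_u le_u']; apply/eqP; rewrite eqn_leq rnd_le //=.
  apply: leq_trans (rnd_mono E ins q le_u).
  exact: join_rnd (sp _ _ _ _ nfp0 nfq (leqnn t) kj0).
have joins : quorum (joiners r (knows p (t + 2 * W))).
  apply: quorumS nonfaulty_quorum; apply/subsetP => q; rewrite !inE => nfq.
  rewrite mul2n -addnn addnA; apply: (sp q) => //; first exact: leq_addr.
  have er := in_r q (t + W) nfq; rewrite -[X in Join q X]er; last by lia.
  by apply: join_current; rewrite er; lia.
have [A kA] : exists A, Lead r A \in knows p (t + 3 * W).
  have [|_ [u /andP[le_u lt_u]]] := spreadT p p (t + 2 * W) nfp nfp; first lia.
  case Eu: (sched E p u) => [ms|] // _.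
  have eq_r : next_round (pax p u) ms = r.
    by rewrite (step_rnd _ Eu); apply: in_r => //; lia.
  have [||A kA] := lead_next (p := p) (s := pax p u) (ms := ms) (ins p u).
  - by rewrite eq_r.
  - rewrite eq_r; apply: quorumS joins; apply/subsetP => q; rewrite !inE.
    exact: knows_mono.
  exists A; move: kA; rewrite eq_r -(pax_step _ Eu); apply: knows_mono; lia.
have cA : (k, v) \in A.
  have [p' [u [ms [_ Eu ru -> ml]]]] := lead_origin (no_creation sysE) kA.
  case/and3P: ml => /eqP + _ _.
  rewrite (step_rnd _ Eu) ru -lead_p => /val_inj eqp.
  rewrite eqp in Eu ru *.
  (* Round [r] is entered after [T], hence after the proposal was made. *)
  have le_su : s.+1 <= u.
    rewrite ltnNge; apply/negP => le_us; case: ft => _ /(_ p u.+1).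
    rewrite ru ltnn => H; suff: false by [].
    by apply: H; rewrite /T in lt_T; lia.
  rewrite mem_cat mem_proposals inE; apply/orP; right; apply/orP; right.
  apply: known_heard; apply: (knows_mono le_su).
  case Es': (sched E p s) Es => [ms'|] // _.
  by rewrite /knows (pax_step _ Es'); apply: proposal_known.
(* The votes are cast by [t + 4 * W]; during the last [W] they only travel, so agents may already
   leave the round. *)
have votes : quorum (voters r (knows p (t + 5 * W))).
  apply: quorumS nonfaulty_quorum; apply/subsetP => q; rewrite !inE => nfq.
  rewrite mulSnr addnA; apply: (sp q) => //; first exact: leq_addr.
  have er := in_r q (t + 4 * W) nfq; rewrite -[X in Vote q X]er; last by lia.
  apply: (vote_current (A := A)); rewrite er; last by lia.
  by rewrite mulSnr addnA; apply: (sp p) => //; apply: leq_addr.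
(* [w] may differ from [v], as an earlier entry for [k] prevails. *)
have [w lw] := lookup_some cA; exists (t + 5 * W), w => ks u ksk le_u.
apply/learnedP; split=> //; exists A => //; apply/chosen_logsP; exists r.
  by apply: knows_mono kA; lia.
apply: quorumS votes; apply/subsetP => q; rewrite !inE; exact: knows_mono.
Qed.

End Timely.
End PaxosLiveness.

(** * Algorithms with consensus objects *)

Section Simulation.
Variables (n : nat) (M V : countType) (In Out : Type).
Variable R : cprotocol n M V In Out.

Local Notation sim_msg := (M + seq (fact n V))%type.

Definition left_msg (m : sim_msg) : option M :=
  if m is inl a then Some a else None.
Definition right_msg (m : sim_msg) : option (seq (fact n V)) :=
  if m is inr K then Some K else None.

Lemma left_msgK : pcancel inl left_msg. Proof. by []. Qed.
Lemma left_msg_inl : ocancel left_msg inl. Proof. by case. Qed.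
Lemma right_msgK : pcancel inr right_msg. Proof. by []. Qed.
Lemma right_msg_inr : ocancel right_msg inr. Proof. by case. Qed.

(** [calls] holds the instances that the agent itself has invoked; [obj_called] forbids responses
    for any other. *)
Record sim_state := SimState {
  client : cstate R; replica : paxos_state n V; calls : seq nat }.

Definition responses (s : sim_state) : seq (nat * V) :=
  learned (calls s) (known (replica s)).

(** Client and replica share the channel through a sum type. Responses are computed from the state
    before the step, so they precede the calls of that step. *)
Definition simulate : protocol n sim_msg In Out :=
  @Protocol n sim_msg In Out sim_state
    (fun p i => SimState (cinit R p i) paxos_init [::])
    (fun p s ms =>
       let r := cstep p (client s) (decode_all left_msg ms) (responses s) in
       let px := paxos_step p (replica s) (decode_all right_msg ms) r.2 in
       (SimState r.1.1 px ([seq c.1 | c <- r.2] ++ calls s),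
        [seq (d.1, inl d.2) | d <- r.1.2] ++
        [seq (d.1, inr d.2) | d <- [seq (q, known px) | q <- enum 'I_n]]))
    (fun s => cout (client s)).

Section SimRun.
Variables (x : 'I_n -> In) (E : env n sim_msg).

Let EM : env n M := env_decode left_msg E.
Let EP : env n (seq (fact n V)) := env_decode right_msg E.

Definition sim_resp p t := responses (state simulate x E p t).
Definition sim_calls p t : seq (nat * V) :=
  if sched EM p t is Some ms then
    (cstep p (crun_state R x EM sim_resp p t) ms (sim_resp p t)).2
  else [::].

(** With responses and calls taken from the simulated run, each half becomes a run against a given
    stream and is analysed separately. *)
Lemma sim_stateP p t :
  client (state simulate x E p t) = crun_state R x EM sim_resp p t /\
  replica (state simulate x E p t) = pax EP sim_calls p t.
Proof.
elim: t => //= t [IHc IHp]; rewrite /sim_calls /=.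
case: (sched E p t) => //= ms.
by rewrite -IHc -IHp /sim_resp.
Qed.

Lemma proposedE p k v t :
  proposed R x EM sim_resp p k v t = ((k, v) \in sim_calls p t).
Proof. by rewrite /proposed /sim_calls; case: (sched EM p t). Qed.

Lemma calls_step p t :
  calls (state simulate x E p t.+1) =
  [seq c.1 | c <- sim_calls p t] ++ calls (state simulate x E p t).
Proof.
have [Hc _] := sim_stateP p t.
by rewrite /sim_calls /= -Hc; case: (sched E p t).
Qed.

Lemma callsP p t k :
  reflect (exists w s, s < t /\ proposed R x EM sim_resp p k w s)
    (k \in calls (state simulate x E p t)).
Proof.
elim: t => [|t IH]; first by constructor=> -[w [s []]].
rewrite calls_step mem_cat.
apply: (iffP orP) => [[/mapP[[k' w] kw /= ->]|/IH[w [s [lt_st pr]]]]|].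
- by exists w, t; rewrite proposedE.
- by exists w, s; rewrite ltnW.
case=> w [s []]; rewrite ltnS leq_eqVlt => /predU1P[->|lt_st pr].
  by rewrite proposedE => kw; left; apply/mapP; exists (k, w).
by right; apply/IH; exists w, s.
Qed.

Lemma csends_simulate p t :
  csends R x EM sim_resp p t =
  decode_all left_msg (psends simulate x E p t).
Proof.
have [Hc _] := sim_stateP p t.
rewrite /csends /psends /= -Hc; case: (sched E p t) => //= ms.
by rewrite decode_all_cat decode_all_map // decode_all_map_None // cats0.
Qed.

Lemma paxos_sends_simulate p t :
  paxos_sends EP sim_calls p t =
  decode_all right_msg (psends simulate x E p t).
Proof.
have [_ Hp] := sim_stateP p t.+1; rewrite /paxos_sends /knows -Hp.
rewrite /psends /=; case: (sched E p t) => //= ms.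
by rewrite decode_all_cat decode_all_map_None // decode_all_map.
Qed.

Lemma poutput_simulate : poutput simulate x E = coutput R x EM sim_resp.
Proof.
do 2 apply: functional_extensionality => ?.
by rewrite /poutput /coutput -(sim_stateP _ _).1.
Qed.

Variable f : nat.
Hypotheses (majority : 2 * f < n) (sysE : system E (psends simulate x E) f).

Let sysM : system EM (csends R x EM sim_resp) f :=
  system_decode left_msgK left_msg_inl csends_simulate sysE.
Let sysP : system EP (paxos_sends EP sim_calls) f :=
  system_decode right_msgK right_msg_inr paxos_sends_simulate sysE.

Lemma sim_respE p t :
  sim_resp p t =
  learned (calls (state simulate x E p t)) (knows EP sim_calls p t).
Proof. by rewrite /sim_resp /responses /knows (sim_stateP p t).2. Qed.

Lemma simulate_objects_safe : objects_safe R x EM sim_resp.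
Proof.
split.
- move=> p q k v w s t /andP[_ kv] /andP[_ kw]; rewrite !sim_respE in kv kw.
  exact: (learned_agree (no_creation sysP) kv kw).
- move=> p k v t /andP[_]; rewrite sim_respE.
  case/(learned_proposed (no_creation sysP)) => q [s [lt_st _ kv]].
  by exists q, s; rewrite proposedE.
- by move=> p k v t /andP[_]; rewrite sim_respE => /learnedP[/callsP].
Qed.

Lemma simulate_objects_live :
  partially_synchronous E (psends simulate x E) ->
  objects_live R x EM sim_resp.
Proof.
move=> /(partially_synchronous_decode right_msgK right_msg_inr).
move=> /(_ _ paxos_sends_simulate)[GST [D timely]] p k v s nfp pr.
have [||t0 [w learn]] :=
  proposal_learned majority sysP timely (s := s) (k := k) (v := v) nfp.
- by move: pr; rewrite /proposed /=; case: (sched E p s).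
- by rewrite -proposedE.
have [t le_t Et] := keeps_running sysM (maxn t0 s.+1) nfp.
exists w, t; split; first by lia.
rewrite /responded Et sim_respE; apply: learn; last by lia.
by apply/callsP; exists v, s; split=> //; lia.
Qed.

End SimRun.

Lemma simulate_solves f (T : task n In Out) : 2 * f < n ->
  (forall (x : 'I_n -> In) (E : env n M) resp,
    system E (csends R x E resp) f -> objects_safe R x E resp ->
    safe T x (coutput R x E resp) /\
    (objects_live R x E resp -> live E (coutput R x E resp))) ->
  solves f simulate T.
Proof.
move=> majority HR x E sysE; rewrite poutput_simulate.
have [safeR liveR] := HR x _ _
  (system_decode left_msgK left_msg_inl (csends_simulate x E) sysE)
  (simulate_objects_safe sysE).
by split=> // /(simulate_objects_live majority sysE)/liveR.
Qed.

End Simulation.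

Lemma reducible_solvable n f (In Out : Type) (T : task n In Out) :
  2 * f < n -> reducible_to_consensus f T ->
  exists (M : countType) (P : protocol n M In Out), solves f P T.
Proof.
move=> majority [M [V [R HR]]].
by exists (M + seq (fact n V))%type, (simulate R); apply: simulate_solves.
Qed.

(** * Consensus as a task reducible to consensus *)

Definition propose_input n (V : eqType) : cprotocol n void V V V :=
  @CProtocol n void V V V (V * option V)
    (fun _ i => (i, None))
    (fun _ s _ rs =>
       (s.1, if s.2 is Some v then Some v else ohead [seq c.2 | c <- rs],
        [::], [:: (0, s.1)]))
    snd.

Section ProposeInput.
Variables (n : nat) (V : eqType) (x : 'I_n -> V) (E : env n void).
Variable resp : 'I_n -> nat -> seq (nat * V).

Local Notation R := (propose_input n V).
Local Notation run := (crun_state R x E resp).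

Lemma run_input p t : (run p t).1 = x p.
Proof. by elim: t => //= t <-; case: (sched E p t). Qed.

Lemma proposed_input p k v t :
  proposed R x E resp p k v t =
  isSome (sched E p t) && ((k, v) == (0, x p)).
Proof.
rewrite /proposed; case: (sched E p t) => //= ms.
by rewrite run_input inE.
Qed.

Lemma run_output p t v : (run p t).2 = Some v ->
  exists k s, responded E resp p k v s.
Proof.
elim: t => //= t IH; case Et: (sched E p t) => [ms|] //=.
case: (run p t).2 IH => [w|_] //; case er: (resp p t) => [|[k w] rs] //= [<-].
by exists k, t; rewrite /responded Et er mem_head.
Qed.

Lemma output_stable p s t v :
  s <= t -> (run p s).2 = Some v -> (run p t).2 = Some v.
Proof.
move=> le_st run_s; elim: t le_st => [|t IH]; first by rewrite leqn0 => /eqP <-.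
rewrite leq_eqVlt => /predU1P[<- //|/IH run_t] /=.
by case: (sched E p t) => //= ms; rewrite run_t.
Qed.

Lemma responded_output p k v t : responded E resp p k v t ->
  isSome (run p t.+1).2.
Proof.
rewrite /responded /=; case: (sched E p t) => //= ms.
by case: (run p t).2 => //; case: (resp p t).
Qed.

End ProposeInput.

Lemma consensus_reducible n f (V : countType) :
  reducible_to_consensus f (@consensus n V).
Proof.
exists void, V, (propose_input n V) => x E resp sysE [agree valid called].
(* Only instance [0] is ever called, so by [obj_called] no other instance responds. *)
have output0 t p v : coutput (propose_input n V) x E resp t p = Some v ->
    exists s, responded E resp p 0 v s.
  move=> /run_output[k [s rs]]; exists s; have [w [u [_]]] := called _ _ _ _ rs.
  by rewrite proposed_input => /andP[_ /eqP[ek _]]; rewrite -ek.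
split=> [|liveO p nfp].
  split=> [t|s t p o]; last exact: output_stable.
  split=> [p q v w /output0[s rv] /output0[u rw]|p v /output0[s rv]].
    exact: (agree _ _ _ _ _ _ _ rv rw).
  have [q [u [_]]] := valid _ _ _ _ rv.
  by rewrite proposed_input => /andP[_ /eqP[->]]; exists q.
have [s _ Es] := keeps_running sysE 0 nfp.
have [|w [t [_ /responded_output out]]] := liveO p 0 (x p) s nfp; last first.
  by exists t.+1; exact: out.
by rewrite proposed_input Es eqxx.
Qed.

Theorem theorem3 (n f : nat) (B : seq tlv) (majority : 2 * f < n) :
  (forall V : countType,
     (forall (M : countType) (P : protocol n M V V),
        solves f P (@consensus n V) ->
        exists Q : protocol n (uacp_msg B) V V,
          implements Q P /\ solves f Q (@consensus n V)) /\
     (exists (M : countType) (P : protocol n M V V)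
             (Q : protocol n (uacp_msg B) V V),
        [/\ solves f P (@consensus n V), implements Q P
          & solves f Q (@consensus n V)])) /\
  (forall (In Out : Type) (T : task n In Out),
     reducible_to_consensus f T ->
     exists Q : protocol n (uacp_msg B) In Out, solves f Q T).
Proof.
(* Both halves of the theorem rest on this transfer through the muACP encoding. *)
have carried (M : countType) In Out (P : protocol n M In Out) T :
    solves f P T -> exists Q : protocol n (uacp_msg B) In Out,
      implements Q P /\ solves f Q T.
  move=> solP; exists (carry (@uacp_enc M B) (@uacp_dec M B) P); split.
    by exists (@uacp_enc M B), (@uacp_dec M B); split; first exact: uacp_encK.
  exact: (carry_solves (@uacp_encK M B) (@uacp_decK M B) solP).
split=> [V|In Out T redT].
  split=> [M P|]; first exact: carried.
  have [M [P solP]] := reducible_solvable majority (@consensus_reducible n f V).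
  by have [Q [impQ solQ]] := carried _ _ _ _ _ solP; exists M, P, Q.
have [M [P /carried[Q [_ solQ]]]] := reducible_solvable majority redT.
by exists Q.
Qed.
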